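(* Let $\psi(\cdot;\theta)$ be the ReLU input convex neural network described in the context, and let $\phi_c\in\mathbb{R}$. For a fixed parameter $y$, the problem $$\min_{z}\; z^TP(y)z+q^T(y)z\quad\text{s.t. } A(y)z=b(y),\; G(y)z\le h(y),\; \psi(z;\theta)\le\phi_c$$ is equivalent to the problem $$\begin{aligned}\min_{z,x_1,\dots,x_k}\;& z^TP(y)z+q^T(y)z\\ \text{s.t. }\;& A(y)z=b(y),\; G(y)z\le h(y),\; x_k\le\phi_c,\\ & x_{i+1}\ge W_i^x x_i+W_i^z z+b_i,\quad i=0,\dots,k-1,\\ & x_i\ge0,\quad i=1,\dots,k-1,\end{aligned}$$ with $x_0=0$, in the following sense: $z$ is feasible for the first problem if and only if there exist $x_1,\dots,x_k$ such that $(z,x_1,\dots,x_k)$ is feasible for the second; hence the two problems have the same optimal value and the same set of optimal $z$-solutions.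
   Context: The network $\psi(\cdot;\theta)$ is defined, for $z\in\mathbb{R}^n$ and $k\ge1$, by $x_0=0$, $x_{i+1}=g_i(W_i^x x_i+W_i^z z+b_i)$ for $i=0,\dots,k-1$, and $\psi(z;\theta)=x_k\in\mathbb{R}$, where $W_i^x,W_i^z$ are real matrices and $b_i$ real vectors of compatible dimensions (the layer bias vectors $b_i$ are unrelated to the right-hand side $b(y)$), $W_0^x=0$, $W_i^x\ge0$ elementwise for $i=1,\dots,k-1$, $g_i$ is the elementwise $\operatorname{ReLU}(s)=\max(0,s)$ for $i=0,\dots,k-2$, and $g_{k-1}$ is the identity. $P(y),A(y),G(y)$ are real matrices and $q(y),b(y),h(y)$ real vectors of compatible dimensions depending on the fixed parameter $y$. Vector inequalities are elementwise. *)

(* Defs.v *)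
From HB Require Import structures.
From mathcomp Require Import all_boot all_order all_algebra.
From mathcomp Require Import all_classical all_reals all_analysis.
Set Implicit Arguments.
Unset Strict Implicit.
Unset Printing Implicit Defensive.
Import Order.TTheory GRing.Theory Num.Theory.
Local Open Scope classical_set_scope.
Local Open Scope ring_scope.

Definition mxle (R : realType) (m p : nat) (A B : 'M[R]_(m, p)) : Prop :=
  forall i j, A i j <= B i j.

Definition relu (R : realType) (s : R) : R := Num.max 0 s.

(* The parameters theta of an input convex network with k layers on R^n.  The
   width of x_i is [width i].  The families are indexed by all of nat so that
   the forward pass is a plain recursion; only layers i < k (and widths
   i <= k) are ever used or constrained. *)
Record icnn (R : realType) (n k : nat) := Icnn {
  width : nat -> nat;
  Wx : forall i, 'M[R]_(width i.+1, width i);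
  Wz : forall i, 'M[R]_(width i.+1, n);
  bias : forall i, 'cV[R]_(width i.+1);
  width_out : width k = 1%N;
  Wx_first : Wx 0 = 0;
  Wx_ge0 : forall i, (1 <= i < k)%N -> mxle 0 (Wx i)
}.

Section Network.
Variables (R : realType) (n k : nat) (theta : icnn R n k).

Definition affine (i : nat) (x : 'cV[R]_(width theta i)) (z : 'cV[R]_n) :
    'cV[R]_(width theta i.+1) :=
  Wx theta i *m x + Wz theta i *m z + bias theta i.

Definition activation (i m : nat) (v : 'cV[R]_m) : 'cV[R]_m :=
  if i == k.-1 then v else map_mx (@relu R) v.

Fixpoint layer (z : 'cV[R]_n) (i : nat) : 'cV[R]_(width theta i) :=
  match i with
  | 0 => 0
  | j.+1 => activation j (affine (layer z j) z)
  end.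

(* R^(width k) is R, since width k = 1. *)
Definition output (v : 'cV[R]_(width theta k)) : R :=
  v (cast_ord (esym (width_out theta)) ord0) ord0.

Definition psi (z : 'cV[R]_n) : R := output (layer z k).

(* (x_0, ..., x_k); x_0 is pinned to 0 in [lifted_network]. *)
Definition layer_vars : Type := forall i : 'I_k.+1, 'cV[R]_(width theta i).

Definition lifted_network (phi_c : R) (z : 'cV[R]_n) (x : layer_vars) : Prop :=
  [/\ x ord0 = 0,
      output (x ord_max) <= phi_c,
      forall i : 'I_k,
        mxle (affine (x (widen_ord (leqnSn k) i)) z) (x (lift ord0 i))
    & forall i : 'I_k.+1, (1 <= i < k)%N -> mxle 0 (x i)].

End Network.

Definition objective (R : realType) (n : nat) (P : 'M[R]_n) (q z : 'cV[R]_n) :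
    R :=
  (z^T *m P *m z + q^T *m z) ord0 ord0.

(* Infimum in the extended reals: +oo if infeasible, -oo if unbounded below. *)
Definition optimal_value (R : realType) (T : Type) (F : set T) (f : T -> R) :
    \bar R :=
  ereal_inf [set (f t)%:E | t in F].

Definition minimizers (R : realType) (T : Type) (F : set T) (f : T -> R) :
    set T :=
  [set t | F t /\ forall t', F t' -> f t <= f t'].

(* Main.v *)
(* Feasible layer variables of the lifted problem dominate the forward pass
   layer by layer: nonnegative weights make each affine map monotone, and
   relu s is the least number above both 0 and s.  Conversely the forward pass
   itself is feasible, so the second problem is a lifting of the first along a
   projection that preserves the cost. *)

Require Import Defs.
From HB Require Import structures.
From mathcomp Require Import all_boot all_order all_algebra.
From mathcomp Require Import all_classical all_reals all_analysis.
From mathcomp Require Import zify.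
Set Implicit Arguments.
Unset Strict Implicit.
Unset Printing Implicit Defensive.
Import Order.TTheory GRing.Theory Num.Theory.
Local Open Scope classical_set_scope.
Local Open Scope ring_scope.

Lemma mxle_mul2l (R : realType) (m n p : nat) (W : 'M[R]_(m, n))
    (u v : 'M[R]_(n, p)) :
  mxle 0 W -> mxle u v -> mxle (W *m u) (W *m v).
Proof.
move=> W0 uv i j; rewrite !mxE; apply: ler_sum => l _.
by apply: ler_wpM2l (uv l j); have := W0 i l; rewrite mxE.
Qed.

Lemma optimal_value_image (R : realType) (T U : Type) (p : U -> T) (F : set U)
    (f : T -> R) :
  optimal_value (p @` F) f = optimal_value F (f \o p).
Proof. by rewrite /optimal_value image_comp. Qed.

(** A cost pulled back along [p] is constant on the fibres of [p], so any preimage of a minimizer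
    minimizes upstairs. *)
Lemma minimizers_image (R : realType) (T U : Type) (p : U -> T) (F : set U)
    (f : T -> R) :
  minimizers (p @` F) f = p @` minimizers F (f \o p).
Proof.
apply/seteqP; split => [_ [[u Fu <-] minu]|_ [u [Fu minu] <-]].
  by exists u => //; split=> // u' Fu'; apply: minu; exists u'.
by split=> [|_ [u' Fu' <-]]; [exists u | exact: minu].
Qed.

Section Lifting.
Variables (R : realType) (n k : nat) (theta : icnn R n k).

(** Layer 0 counts as nonnegative because its weight is zero; monotonicity then needs no separate
    first layer. *)
Lemma Wx_lt_ge0 (i : nat) : (i < k)%N -> mxle 0 (Wx theta i).
Proof.
case: i => [_ | i ik]; last exact: Wx_ge0.
by rewrite Wx_first.
Qed.

Lemma affine_le (i : nat) (u v : 'cV[R]_(width theta i)) (z : 'cV[R]_n) :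
  (i < k)%N -> mxle u v -> mxle (affine u z) (affine v z).
Proof.
move=> ik uv a c; have := mxle_mul2l (Wx_lt_ge0 ik) uv a c.
by rewrite /affine !mxE !lerD2r.
Qed.

Lemma activation_ge (i m : nat) (v : 'cV[R]_m) : mxle v (activation k i v).
Proof.
by move=> a c; rewrite /activation; case: eqP => // _; rewrite mxE le_max lexx orbT.
Qed.

(** The sign of [w] is asked for only where the activation is relu: the last layer is the identity,
    and its lifted variable has no sign constraint. *)
Lemma activation_le (i m : nat) (v w : 'cV[R]_m) :
  (i < k)%N -> mxle v w -> ((i.+1 < k)%N -> mxle 0 w) ->
  mxle (activation k i v) w.
Proof.
move=> ik vw w0 a c; rewrite /activation; case: eqP => [_|/eqP ik1]; first exact: vw.
rewrite mxE ge_max vw andbT.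
have /w0 /(_ a c) : (i.+1 < k)%N by lia.
by rewrite mxE.
Qed.

Lemma layer_ge0 (z : 'cV[R]_n) (i : nat) :
  (1 <= i < k)%N -> mxle 0 (layer theta z i).
Proof.
(* Layer [i.+1] comes out of activation [i], and [i.+1 < k] rules out the identity case
   [i = k.-1]. *)
case: i => // i ik a c /=; rewrite /activation ifF; last by apply/eqP; lia.
by rewrite !mxE le_max lexx.
Qed.

Lemma layer_le_lifted (phi_c : R) (z : 'cV[R]_n) (x : layer_vars theta) :
  lifted_network phi_c z x -> forall i : 'I_k.+1, mxle (layer theta z i) (x i).
Proof.
(* Induction on a bound for [i], since [x] is indexed by ordinals. Next, [unliftP] separates [x_0]
   from the successors, whose index [j : 'I_k] is that of the constraints. *)
move=> [x0 _ xS xge0] i; have [m] := ubnP (i : nat); elim: m i => // m IH i.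
case: (unliftP ord0 i) => [j -> | -> _]; last by rewrite x0.
rewrite ltnS => jm; apply: activation_le => //.
  move=> a c; apply: le_trans (xS j a c); apply: affine_le => //.
  exact: (IH (widen_ord (leqnSn k) j)).
by move=> jk; apply: (xge0 (lift ord0 j)); rewrite lift0.
Qed.

Lemma psi_le_lifted (phi_c : R) (z : 'cV[R]_n) :
  psi theta z <= phi_c <-> exists x, lifted_network (theta := theta) phi_c z x.
Proof.
split=> [psiz | [x xP]].
  exists (fun i => layer theta z i); split=> // i; last exact: layer_ge0.
  exact: activation_ge.
case: (xP) => _ xk _ _; apply: le_trans xk.
exact: (layer_le_lifted xP (i := ord_max)).
Qed.

End Lifting.

Theorem proposition3 (R : realType) (n k meq mineq : nat) (hk : (1 <= k)%N)
    (theta : icnn R n k) (phi_c : R) (Y : Type)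
    (P : Y -> 'M[R]_n) (q : Y -> 'cV[R]_n)
    (A : Y -> 'M[R]_(meq, n)) (b : Y -> 'cV[R]_meq)
    (G : Y -> 'M[R]_(mineq, n)) (h : Y -> 'cV[R]_mineq) (y : Y) :
  let feasible1 : set 'cV[R]_n :=
    [set z | [/\ A y *m z = b y, mxle (G y *m z) (h y)
               & psi theta z <= phi_c]] in
  let feasible2 : set ('cV[R]_n * layer_vars theta) :=
    [set zx | [/\ A y *m zx.1 = b y, mxle (G y *m zx.1) (h y)
                & lifted_network phi_c zx.1 zx.2]] in
  let cost1 := fun z : 'cV[R]_n => objective (P y) (q y) z in
  let cost2 := fun zx : 'cV[R]_n * layer_vars theta =>
    objective (P y) (q y) zx.1 in
  [/\ forall z, feasible1 z <-> exists x, feasible2 (z, x),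
      optimal_value feasible1 cost1 = optimal_value feasible2 cost2
    & minimizers feasible1 cost1 = fst @` minimizers feasible2 cost2].
Proof.
move=> F1 F2 c1 c2.
have F12 z : F1 z <-> exists x, F2 (z, x).
  split=> [[Az Gz /psi_le_lifted[x xP]] | [x [Az Gz xP]]]; first by exists x.
  by split=> //; apply/psi_le_lifted; exists x.
have F1E : F1 = fst @` F2.
  apply/seteqP; split=> [z /F12[x xP] | _ [[z x] xP <-]]; first by exists (z, x).
  by apply/F12; exists x.
(* [c2] is [c1 \o fst] by conversion. *)
by split=> //; rewrite F1E; [exact: optimal_value_image | exact: minimizers_image].
Qed.
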